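(* For every integer $k \geq 1$, the minimum distance $r_k$, the maximum distance $R_k$ and the width $W_k = R_k - r_k$ of the $k$-th Brillouin zone of any point in the integer lattice $\mathbb{Z}^d$ satisfy $$\sqrt[d]{k/\nu_d} - \tfrac{\sqrt d}{2} < r_k < \sqrt[d]{(k-1)/\nu_d},$$ $$\sqrt[d]{k/\nu_d} < R_k < \sqrt[d]{k/\nu_d} + \tfrac{\sqrt d}{2},$$ $$\sqrt[d]{k/\nu_d} - \sqrt[d]{(k-1)/\nu_d} < W_k < \sqrt d .$$
   Context: $\|\cdot\|$ is the Euclidean norm and $\nu_d$ is the $d$-dimensional volume of the unit ball in $\mathbb{R}^d$. For a locally finite set $A \subseteq \mathbb{R}^d$ (every closed ball contains finitely many points of $A$) with $0 \in A$ and an integer $k \geq 1$, the $k$-th Brillouin zone of $0$, $\mathrm{Zone}_k(0,A)$, is the set of $x \in \mathbb{R}^d$ such that $\|x-a\| < \|x\|$ for at most $k-1$ points $a \in A\setminus\{0\}$ and $\|x-b\| \leq \|x\|$ for at least $k-1$ points $b \in A \setminus\{0\}$. The zone of another point of $A$ is defined analogously, with that point in place of $0$. The minimum and maximum distances of the zone of a point are the minimum and maximum Euclidean distances from that point to the points of its zone; for a lattice they are the same for all lattice points, so $r_k$ and $R_k$ are the minimum and maximum of $\|x\|$ over $x \in \mathrm{Zone}_k(0,\mathbb{Z}^d)$.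
   Formalization: Strictness fails for d = 1 (both bounds on r_k and the lower bounds on R_k and W_k are equalities) and for k = 1 in the upper bound on r_k (both sides are 0); exactly there ''<'' is replaced by ''≤'', and d ≥ 1 is assumed. *)

(* Defs.v *)
From mathcomp Require Import all_boot all_order all_algebra.
From mathcomp Require Import all_classical all_reals all_analysis.

Set Implicit Arguments.
Unset Strict Implicit.
Unset Printing Implicit Defensive.

Import Order.TTheory GRing.Theory Num.Theory.

Local Open Scope classical_set_scope.
Local Open Scope card_scope.
Local Open Scope ring_scope.

(* The norm [`|x|] that the library puts on ['rV[R]_d] is the maximum norm. *)
Definition enorm (R : realType) (d : nat) (x : 'rV[R]_d) : R :=
  Num.sqrt (\sum_(i < d) x 0 i ^+ 2).

(* d-dimensional Lebesgue measure of a (Borel) set.  The measure on R^(1+d) is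
   the product of the Lebesgue measure on R and the one on R^d, evaluated, as
   in the library's product measure [\x], by integrating the measures of the
   sections; the measure on the one-point space R^0 is the Dirac measure
   (the type ['rV[R]_0] has the single element 0). *)
Fixpoint volume (R : realType) (d : nat) : set 'rV[R]_d -> \bar R :=
  match d with
  | 0%N => fun A => (\1_A (0 : 'rV[R]_0))%:E
  | d'.+1 => fun A =>
      (\int[@lebesgue_measure R]_t
         volume [set y : 'rV[R]_d' | A (row_mx (t%:M : 'M[R]_1) y)])%E
  end.

Definition unit_ball_volume (R : realType) (d : nat) : R :=
  fine (volume [set x : 'rV[R]_d | enorm x <= 1]).

Definition integer_lattice (R : realType) (d : nat) : set 'rV[R]_d :=
  [set x | forall i, x 0 i \is a Num.int].
Arguments integer_lattice : clear implicits.

(* k-th Brillouin zone of p in A, for k >= 1; [X #<= `I_m] and [`I_m #<= X]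
   say that X has at most, respectively at least, m elements. *)
Definition brillouin_zone (R : realType) (d k : nat) (A : set 'rV[R]_d)
    (p : 'rV[R]_d) : set 'rV[R]_d :=
  [set x |
    [set a | [/\ A a, a <> p & enorm (x - a) < enorm (x - p)]] #<= `I_(k - 1)
    /\
    `I_(k - 1) #<= [set b | [/\ A b, b <> p & enorm (x - b) <= enorm (x - p)]]].

Definition zone_distances (R : realType) (d k : nat) (A : set 'rV[R]_d)
    (p : 'rV[R]_d) : set R :=
  [set enorm (x - p) | x in brillouin_zone k A p].

Definition is_minimum (R : realType) (S : set R) (m : R) : Prop :=
  S m /\ lbound S m.

Definition is_maximum (R : realType) (S : set R) (m : R) : Prop :=
  S m /\ ubound S m.

(* For x >= 0 and d > 0 this is the nonnegative d-th root; in particular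
   [nth_root d 0 = 0], since the exponent is nonzero. *)
Definition nth_root (R : realType) (d : nat) (x : R) : R := x `^ (d%:R^-1).

(* Main.v *)
Require Import Defs.
From mathcomp Require Import all_boot all_order all_algebra finmap.
From mathcomp Require Import all_classical all_reals all_analysis.
From mathcomp Require Import measurable_realfun zify ring lra.

(** Everything is expressed through the number [ball_count b x r] of lattice
    points in the open ([b = false]) or closed ([b = true]) ball of center [x]
    and radius [r].  A point [x] lies in the [k]-th zone of a lattice point [p]
    if and only if [enorm (x - p)] is the distance from [x] to its [k]-th
    nearest lattice point ([brillouin_zoneP]).  Since one may translate any of
    the lattice points at that distance to [p], the distances of the zone are
    exactly the values, at all points of the space, of the distance to the
    [k]-th nearest lattice point ([zone_distancesP]).  This function is
    1-Lipschitz and periodic, so it has a minimum [r_k] and a maximum [R_k]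
    ([exists_extreme_kth_distances]).

    The link with volume is an averaging identity: the mean of
    [ball_count b y r] over a period is [nu * r ^+ d].  It is used on finite
    samples: over the points of a grid of mesh [1/n] in a period, the sum of
    the counts is exactly the number of lattice points in the ball of radius
    [n * r] ([sum_ball_count_period]), and this number is equivalent to
    [nu * (n * r) ^+ d] ([count0_density]) because the unit ball is squeezed
    between unions of small cubes ([unit_ball_volumeP]).  The volume of such a
    union is an iterated integral of step functions ([volume_cells]), and the
    iterated integral is monotone on arbitrary sets ([volume_le]).

    If every closed ball of radius [r] contains at least [k] lattice points,
    then [k <= nu * r ^+ d] ([volume_ge_of_covering]); if every open ball of
    radius [r] contains at most [m], then [nu * r ^+ d <= m]
    ([volume_le_of_packing]).  For [d >= 2] and [r > 0] both are strict: the
    count takes different values on two small balls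
    ([ball_count_oscillation]), so it is not almost everywhere equal to its
    extreme value.

    The covering bound applies to [R_k], and also to [r_k + sqrt d / 2]: some
    closed ball of radius [r_k] contains [k] points, and its center is within
    [sqrt d / 2] of any point modulo the lattice.  Symmetrically the packing
    bound with [m = k - 1] applies to [r_k] and to [R_k - sqrt d / 2].  Taking
    [d]-th roots gives the bounds on [r_k] and [R_k], those on the width
    follow, and the upper bounds on [R_k] and on the width are strict in every
    dimension because [k - 1] improves on [k]. *)

Set Implicit Arguments.
Unset Strict Implicit.
Unset Printing Implicit Defensive.

Import Order.TTheory GRing.Theory Num.Theory.
Import numFieldNormedType.Exports.

Local Open Scope classical_set_scope.
Local Open Scope card_scope.
Local Open Scope ring_scope.

(** * The Euclidean norm *)

Section EuclideanNorm.
Variables (R : realType) (d : nat).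
Implicit Types x y : 'rV[R]_d.

Lemma enorm_ge0 x : 0 <= enorm x.
Proof. exact: sqrtr_ge0. Qed.

Lemma sqr_enorm x : enorm x ^+ 2 = \sum_(i < d) x 0 i ^+ 2.
Proof. by rewrite sqr_sqrtr// sumr_ge0// => i _; exact: sqr_ge0. Qed.

Lemma enorm0 : enorm (0 : 'rV[R]_d) = 0.
Proof.
by rewrite /enorm big1 ?sqrtr0// => i _; rewrite mxE expr0n.
Qed.

Lemma enormZ c x : enorm (c *: x) = `|c| * enorm x.
Proof.
rewrite /enorm -sqrtr_sqr -sqrtrM ?sqr_ge0//; congr Num.sqrt.
by rewrite mulr_sumr; apply: eq_bigr => i _; rewrite mxE exprMn.
Qed.

Lemma enormN x : enorm (- x) = enorm x.
Proof. by rewrite -scaleN1r enormZ normrN1 mul1r. Qed.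

Lemma enormB x y : enorm (x - y) = enorm (y - x).
Proof. by rewrite -enormN opprB. Qed.

Lemma normr_le_enorm x i : `|x 0 i| <= enorm x.
Proof.
rewrite -sqrtr_sqr ler_wsqrtr// (bigD1 i)//= lerDl sumr_ge0// => j _.
exact: sqr_ge0.
Qed.

Lemma enorm_eq0 x : enorm x = 0 -> x = 0.
Proof.
move=> x0; apply/rowP => i; rewrite mxE; apply/eqP; rewrite -normr_eq0.
by rewrite eq_le normr_ge0 -x0 normr_le_enorm.
Qed.

Lemma enorm_le_sqrtM x c : (forall i, `|x 0 i| <= c) ->
  enorm x <= Num.sqrt d%:R * c.
Proof.
case: (pselect (0 <= c)) => [c0|c0] xc.
  rewrite -[X in _ * X](ger0_norm c0) -sqrtr_sqr -sqrtrM ?ler0n//.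
  rewrite ler_wsqrtr// mulr_natl -[X in _ *+ X]card_ord -sumr_const.
  by apply: ler_sum => i _; rewrite -real_normK ?num_real// lerXn2r ?nnegrE.
rewrite /enorm big1 ?sqrtr0; last first.
  move=> i _; exfalso; apply: c0; exact: le_trans (xc i).
case: (posnP d) => [->|d0]; first by rewrite sqrtr0 mul0r.
by exfalso; apply: c0; exact: le_trans (xc (Ordinal d0)).
Qed.

Lemma cauchy_schwarz x y :
  \sum_(i < d) x 0 i * y 0 i <= enorm x * enorm y.
Proof.
have [x0|x0] := eqVneq (enorm x) 0.
  rewrite x0 mul0r (enorm_eq0 x0) big1// => i _; by rewrite mxE mul0r.
have [y0|y0] := eqVneq (enorm y) 0.
  rewrite y0 mulr0 (enorm_eq0 y0) big1// => i _; by rewrite mxE mulr0.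
have xy : 0 < 2 * (enorm x * enorm y).
  by rewrite !mulr_gt0// lt_def enorm_ge0 ?x0 ?y0.
rewrite -subr_ge0 -(pmulr_rge0 _ xy).
set a := enorm x in xy *; set b := enorm y in xy *; set s := \sum_(_ < _) _.
suff -> : 2 * (a * b) * (a * b - s) =
    \sum_(i < d) (b * x 0 i - a * y 0 i) ^+ 2.
  by rewrite sumr_ge0// => i _; exact: sqr_ge0.
transitivity (b ^+ 2 * (\sum_(i < d) x 0 i ^+ 2) - 2 * (a * b) * s +
    a ^+ 2 * (\sum_(i < d) y 0 i ^+ 2)).
  by rewrite -!sqr_enorm -/a -/b; ring.
rewrite /s !mulr_sumr -sumrB -big_split/=.
by apply: eq_bigr => i _; ring.
Qed.

Lemma enormD x y : enorm (x + y) <= enorm x + enorm y.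
Proof.
rewrite -(@ler_pXn2r _ 2)// ?nnegrE ?addr_ge0 ?enorm_ge0//.
rewrite sqrrD !sqr_enorm.
under eq_bigr do rewrite mxE sqrrD.
rewrite !big_split/= lerD2r lerD2l mulr2n.
by apply: lerD; exact: cauchy_schwarz.
Qed.

Lemma enorm_triangle x y z : enorm (x - z) <= enorm (x - y) + enorm (y - z).
Proof. by rewrite -{1}(subrK y x) -addrA enormD. Qed.

Lemma enorm_leD_dist x y : enorm x <= enorm y + enorm (x - y).
Proof. by rewrite -{1}(subrK y x) addrC enormD. Qed.

End EuclideanNorm.

(** * Counting lattice points in balls *)

Lemma leq_card_fset_set_inj (T U : choiceType) (f : T -> U) (A : set T)
    (B : set U) : finite_set B -> injective f ->
  (forall x, A x -> B (f x)) -> (#|` fset_set A| <= #|` fset_set B|)%N.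
Proof.
move=> finB injf AB; have AleB : A #<= B.
  rewrite -(card_le_eql (inj_card_eq (in2W injf))).
  by apply: subset_card_le => _ [x Ax <-]; exact: AB.
have /finite_setP[m Bm] := finB.
rewrite (card_fset_set Bm); apply: geq_card_fset_set.
by rewrite -(card_le_eqr Bm).
Qed.

Lemma exists_lt_seq (R : realFieldType) (s : seq R) :
  {in s, forall x, 0 < x} -> exists2 e, 0 < e & {in s, forall x, e < x}.
Proof.
elim: s => [_|h t ih hp]; first by exists 1.
have [|e e0 et] := ih; first by move=> x xt; apply: hp; rewrite inE xt orbT.
have h0 : 0 < h by apply: hp; rewrite inE eqxx.
exists (Num.min e (h / 2)); first by rewrite lt_min e0 divr_gt0.
move=> x; rewrite inE => /predU1P[->|/et ex]; rewrite gt_min ?ex//.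
by apply/orP; right; lra.
Qed.

Section LatticeCount.
Variables (R : realType) (d : nat).
Implicit Types (x y : 'rV[R]_d) (a : 'rV[int]_d) (r s : R) (b : bool).

Definition ball_points b x r : set 'rV[int]_d :=
  [set a | enorm (x - map_mx intr a) < r ?<= if b].

Definition ball_count b x r : nat := #|` fset_set (ball_points b x r)|.

Lemma finite_int_box (M : nat) :
  finite_set [set a : 'rV[int]_d | forall i, `|a 0 i| <= M%:Z].
Proof.
pose f (u : 'rV['I_(M + M).+1]_d) : 'rV[int]_d := \row_i ((u 0 i)%:Z - M%:Z).
apply: (@sub_finite_set _ _ (f @` setT)); last first.
  by apply: finite_image; exact: finite_finset.
move=> a /= aM; exists (\row_i inord (absz (a 0 i + M%:Z))) => //.
apply/rowP => i; rewrite !mxE inordK; have := aM i; lia.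
Qed.

Lemma finite_ball_points b x r : finite_set (ball_points b x r).
Proof.
pose M := Num.truncn (r + enorm x).
apply: sub_finite_set (finite_int_box M.+1) => a /lteifW ar i.
have : `|(a 0 i)%:~R : R| <= r + enorm x.
  have -> : (a 0 i)%:~R = (map_mx intr a : 'rV[R]_d) 0 i by rewrite mxE.
  apply: le_trans (normr_le_enorm _ _) _.
  rewrite (le_trans (enorm_leD_dist _ x))// addrC lerD2r.
  by rewrite enormB.
rewrite -intr_norm => /le_lt_trans/(_ (truncnS_gt _)).
by rewrite -/M pmulrn ltr_int => /ltW.
Qed.

(** The translation by [c] in the target serves the invariance of the counts
    under the lattice. *)
Lemma leq_ball_count_add b b' x y r s (c : 'rV[int]_d) :
  (forall a, ball_points b x r a -> ball_points b' y s (a + c)) ->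
  (ball_count b x r <= ball_count b' y s)%N.
Proof.
move=> H; apply: (@leq_card_fset_set_inj _ _ (fun a => a + c)) => //.
- exact: finite_ball_points.
- exact: addIr.
Qed.

Lemma leq_ball_count b b' x y r s : ball_points b x r `<=` ball_points b' y s ->
  (ball_count b x r <= ball_count b' y s)%N.
Proof.
move=> H; apply: (@leq_ball_count_add _ _ _ _ _ _ 0) => a; rewrite addr0.
exact: H.
Qed.

Lemma ball_count_translate b x r (c : 'rV[int]_d) :
  ball_count b (x + map_mx intr c) r = ball_count b x r.
Proof.
apply/eqP; rewrite eqn_leq; apply/andP; split.
  apply: (@leq_ball_count_add _ _ _ _ _ _ (- c)) => a.
  by rewrite /ball_points/= map_mxB opprB addrA addrAC.
apply: (@leq_ball_count_add _ _ _ _ _ _ c) => a.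
by rewrite /ball_points/= map_mxD opprD [- _ - _]addrC addrA addrK.
Qed.

Lemma leq_ball_count_move b x y r s : enorm (x - y) + r <= s ->
  (ball_count b x r <= ball_count b y s)%N.
Proof.
move=> xys; apply: leq_ball_count => a; rewrite /ball_points/= => ar.
have := enorm_triangle y x (map_mx intr a); rewrite [enorm (y - x)]enormB.
move: ar xys; case: b => /=; lra.
Qed.

Lemma leq_ball_count_strict x r :
  (ball_count false x r <= ball_count true x r)%N.
Proof. by apply: leq_ball_count => a /= /lteifW. Qed.

Lemma leq_ball_count_lt b b' x r s : r < s ->
  (ball_count b x r <= ball_count b' x s)%N.
Proof.
move=> rs; apply: leq_ball_count => a /= /lteifW ar.
by apply/lteifS/(le_lt_trans ar).
Qed.

Lemma leq_ball_count_radius b x r s : r <= s ->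
  (ball_count b x r <= ball_count b x s)%N.
Proof.
by move=> rs; apply: leq_ball_count_move; rewrite subrr enorm0 add0r.
Qed.

Lemma ball_count_lt0 b x r : r < 0 -> ball_count b x r = 0%N.
Proof.
move=> r0; rewrite /ball_count (_ : ball_points _ _ _ = set0) ?fset_set0//.
apply/seteqP; split => // a; rewrite /ball_points/= => /lteifW.
by rewrite leNgt (lt_le_trans r0) ?enorm_ge0.
Qed.

(** Only the finitely many distances at most [r + 1] can come close to [r]. *)
Lemma distance_gap x r : exists2 eta, 0 < eta &
  forall a, let D := enorm (x - map_mx intr a) in D != r -> eta < `|D - r|.
Proof.
pose dist a := enorm (x - map_mx intr a).
pose F := fset_set (ball_points true x (r + 1)).
pose s := [seq `|dist a - r| | a <- enum_fset F & dist a != r].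
have [|e e0 es] := @exists_lt_seq R s.
  move=> e /mapP[a]; rewrite mem_filter => /andP[ar _] ->.
  by rewrite normr_gt0 subr_eq0.
exists (Num.min e 1); first by rewrite lt_min e0 ltr01.
move=> a /=; rewrite -/(dist a) => ar; rewrite gt_min.
have [ar1|ar1] := leP (dist a) (r + 1).
  rewrite es//; apply/mapP; exists a => //; rewrite mem_filter ar/=.
  by rewrite in_fset_set ?inE//; exact: finite_ball_points.
by apply/orP; right; rewrite ger0_norm; lra.
Qed.

Lemma exists_ball_count_ge x k : (0 < d)%N ->
  exists r, (k <= ball_count true x r)%N.
Proof.
move=> d0; exists (enorm x + Num.sqrt d%:R * k%:R).
rewrite -[X in (X <= _)%N](card_fset_set (card_eqxx `I_k)).
apply: (@leq_card_fset_set_inj _ _ (fun j : nat => const_mx j%:Z)).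
- exact: finite_ball_points.
- by move=> i j /rowP/(_ (Ordinal d0)); rewrite !mxE => -[].
- move=> j /= jk; rewrite /ball_points/= (le_trans (enormD _ _))//.
  rewrite lerD2l enormN enorm_le_sqrtM// => i; rewrite !mxE.
  by rewrite -pmulrn normr_nat ler_nat ltnW.
Qed.

(** * The distance to the k-th nearest lattice point *)

(** Ties are allowed: [r] is the distance to the [k]-th nearest lattice point
    for any way of ordering the points by their distance to [x]. *)
Definition is_kth_distance (k : nat) x r : Prop :=
  (ball_count false x r < k <= ball_count true x r)%N.

Lemma kth_distance_lipschitz k x y r s :
  is_kth_distance k x r -> is_kth_distance k y s -> s <= r + enorm (x - y).
Proof.
move=> /andP[_ kx] /andP[ky _]; rewrite leNgt; apply/negP => rs.
have : (k < k)%N; last by rewrite ltnn.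
apply: leq_ltn_trans ky; apply: leq_trans kx _.
rewrite (leq_trans _ (leq_ball_count_lt true false y rs))// leq_ball_count_move//.
by rewrite addrC.
Qed.

Lemma kth_distance_uniq k x r s :
  is_kth_distance k x r -> is_kth_distance k x s -> r = s.
Proof.
move=> xr xs; apply/eqP; rewrite eq_le.
have := kth_distance_lipschitz xr xs; have := kth_distance_lipschitz xs xr.
by rewrite subrr enorm0 !addr0 => -> ->.
Qed.

Lemma kth_distance_ge0 k x r : is_kth_distance k x r -> 0 <= r.
Proof.
move=> /andP[kf kt]; rewrite leNgt; apply/negP => r0.
by move: kf kt; rewrite !ball_count_lt0//; lia.
Qed.

(** The infimum of the radii of closed balls with at least [k] points is
    attained because distances are isolated. *)
Lemma exists_kth_distance k x : (0 < d)%N -> (0 < k)%N ->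
  exists r, is_kth_distance k x r.
Proof.
move=> d0 k0; pose E := [set r | (k <= ball_count true x r)%N].
have E0 : lbound E 0.
  move=> r /= kr; rewrite leNgt; apply/negP => r0.
  by move: kr; rewrite /E/= ball_count_lt0// leqNgt k0.
have EI : has_inf E.
  by split; [exact: exists_ball_count_ge|exists 0].
have [eta eta0 gap] := distance_gap x (inf E).
(* No distance lies within [eta] of [inf E], other than [inf E] itself: the
   closed ball does not grow up to radius [inf E + eta], and the open ball is
   already the closed ball of radius [inf E - eta]. *)
exists (inf E); apply/andP; split; last first.
  have [s Es sE] := inf_adherent eta0 EI.
  apply: leq_trans Es _; apply: leq_ball_count => a; rewrite /ball_points/=.
  move=> as_; rewrite leNgt; apply/negP => aE.
  have /= := gap a; rewrite gt_eqF// => /(_ isT).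
  by rewrite gtr0_norm ?subr_gt0//; lra.
rewrite ltnNge; apply/negP => kE.
suff : E (inf E - eta) by move/(ge_inf EI.2); lra.
apply: leq_trans kE _; apply: leq_ball_count => a; rewrite /ball_points/=.
move=> aE.
have /= := gap a; rewrite lt_eqF// => /(_ isT).
by rewrite ltr0_norm ?subr_lt0//; lra.
Qed.

End LatticeCount.

(** * Volume of finite unions of grid cells *)

Lemma card_fset_set_image_inj (T U : choiceType) (f : T -> U) (A : set T) :
  finite_set A -> injective f -> #|` fset_set (f @` A)| = #|` fset_set A|.
Proof. by move=> finA injf; rewrite fset_set_image// card_imfset. Qed.

Lemma card_fset_set_fiber (T U : choiceType) (h : T -> U) (S : set T) (j : U) :
  finite_set S ->
  (\sum_(i <- fset_set S | h i == j) 1)%N =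
  #|` fset_set (S `&` h @^-1` [set j])|.
Proof.
move=> finS; rewrite card_fset_sum1 big_fset_condE/=.
apply: eq_fbigl => x; rewrite !inE/= !in_fset_set//; last exact: finite_setIl.
by apply/idP/idP; rewrite in_setI => /andP[->]; rewrite !inE/= => /eqP.
Qed.

Lemma card_fset_set_fibers (T U : choiceType) (h : T -> U) (S : set T) :
  finite_set S -> #|` fset_set S| =
    (\sum_(j <- fset_set (h @` S)) #|` fset_set (S `&` h @^-1` [set j])|)%N.
Proof.
move=> finS; rewrite card_fset_sum1 (partition_big_imfset _ h) fset_set_image//.
by apply: eq_bigr => j _; rewrite card_fset_set_fiber.
Qed.

Lemma card_fset_set_fin_fibers (T : choiceType) (J : finType) (h : T -> J)
    (S : set T) : finite_set S ->
  #|` fset_set S| = (\sum_(j : J) #|` fset_set (S `&` h @^-1` [set j])|)%N.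
Proof.
move=> finS; rewrite card_fset_sum1 (partition_big h predT)//=.
by apply: eq_bigr => j _; rewrite -card_fset_set_fiber.
Qed.

(** The integral of a nonnegative function is a supremum over the simple
    functions below it, hence is monotone also on non-measurable functions,
    such as the section volumes of arbitrary sets may be. *)
Lemma integral_mono_ge0 d (T : measurableType d) (R : realType)
    (mu : {measure set T -> \bar R}) (f g : T -> \bar R) :
  (forall x, 0 <= f x)%E -> (forall x, f x <= g x)%E ->
  (\int[mu]_x f x <= \int[mu]_x g x)%E.
Proof.
move=> f0 fg; rewrite !ge0_integralTE//; last first.
  by move=> x; exact: le_trans (fg x).
by apply: ereal_sup_le => _ [h hf <-]; exists h => // x; exact: le_trans (fg x).
Qed.

Section Volume.
Variable R : realType.

Lemma volume_ge0 d (A : set 'rV[R]_d) : (0 <= volume A)%E.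
Proof.
elim: d A => [|d IH] A /=; first by rewrite lee_fin indicE.
by apply: integral_ge0 => t _; exact: IH.
Qed.

Lemma volume_le d (A B : set 'rV[R]_d) : A `<=` B -> (volume A <= volume B)%E.
Proof.
elim: d A B => [|d IH] A B AB /=.
  rewrite lee_fin !indicE ler_nat.
  by have [/set_mem/AB/mem_set ->|] := boolP (0 \in A).
apply: integral_mono_ge0 => t; first exact: volume_ge0.
by apply: IH => y; exact: AB.
Qed.

(** The index of the cell of mesh [1/n] that contains [x]. *)
Definition cell_index (n d : nat) (x : 'rV[R]_d) : 'rV[int]_d :=
  \row_i Num.floor (n%:R * x 0 i).

Lemma cell_index_row_mx n d (t : R) (y : 'rV[R]_d) :
  cell_index n (row_mx (t%:M : 'M[R]_1) y) =
  row_mx (Num.floor (n%:R * t))%:M (cell_index n y).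
Proof.
apply/rowP => i; rewrite mxE; case: (split_ordP i) => j ->.
  by rewrite !row_mxEl !ord1 !mxE.
by rewrite !row_mxEr !mxE.
Qed.

Lemma floor_cell_measure n (m : int) : (0 < n)%N ->
  measurable [set t : R | Num.floor (n%:R * t) = m] /\
  lebesgue_measure [set t : R | Num.floor (n%:R * t) = m] = (n%:R^-1)%:E.
Proof.
move=> n0; have nR : 0 < n%:R :> R by rewrite ltr0n.
have -> : [set t : R | Num.floor (n%:R * t) = m] =
    `[m%:~R / n%:R, (m + 1)%:~R / n%:R[%classic.
  apply/seteqP; split=> t /=; rewrite in_itv/= ler_pdivrMr// ltr_pdivlMr//.
    by move/eqP; rewrite floor_eq ![t * _]mulrC.
  by move=> H; apply/eqP; rewrite floor_eq ![n%:R * _]mulrC.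
split; first exact: measurable_itv.
rewrite lebesgue_measure_itv/= lte_fin ltr_pM2r ?invr_gt0// ltr_int.
rewrite ltrDl/= -EFinB -mulrBl -intrB.
by rewrite addrAC subrr add0r mul1r.
Qed.

(** The section at [t] of a union of cells of dimension [d + 1] is the union
    of the cells of dimension [d] whose index extends [floor (n t)] to an index
    in [S]; the integrand of the volume is therefore a step function of [t]. *)
Lemma volume_cells n d (S : set 'rV[int]_d) : (0 < n)%N -> finite_set S ->
  volume [set x : 'rV[R]_d | S (cell_index n x)] =
  (#|` fset_set S|%:R * n%:R^-1 ^+ d)%:E.
Proof.
move=> n0; elim: d S => [|d IH] S finS.
  rewrite /= indicE expr0 mulr1; congr (_%:E).
  have -> : S = if `[< S 0 >] then [set 0] else set0.
    apply/seteqP; split=> x; rewrite thinmx0; case: asboolP => //.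
  case: asboolP => S0.
    by rewrite mem_set/= ?fset_set1 ?cardfs1// thinmx0.
  by rewrite memNset//= ?fset_set0//; rewrite thinmx0.
pose slice (m : int) : set 'rV[int]_d :=
  [set z | S (row_mx (m%:M : 'M[int]_1) z)].
pose first (a : 'rV[int]_d.+1) : int := a 0 0.
have l0 : lshift d (0 : 'I_1) = 0 :> 'I_d.+1 by apply/val_inj.
have row_inj (m : int) :
    injective (fun z : 'rV[int]_d => row_mx (m%:M : 'M[int]_1) z).
  by move=> y z /eq_row_mx[].
have sliceE m : S `&` first @^-1` [set m] =
    (fun z : 'rV[int]_d => row_mx (m%:M : 'M[int]_1) z) @` slice m.
  apply/seteqP; split=> [a [Sa /= <-]|_ [z Sz <-]]; last first.
    split => //=; rewrite /first -l0.
    by apply: etrans (row_mxEl _ _ _ _) _; rewrite mxE.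
  have aE :
      row_mx ((first a)%:M : 'M[int]_1) (rsubmx (a : 'rV[int]_(1 + d))) = a.
    apply: etrans (hsubmxK (a : 'rV[int]_(1 + d))); congr row_mx.
    rewrite [RHS]mx11_scalar; congr (_%:M); by rewrite mxE /first -l0.
  exists (rsubmx (a : 'rV[int]_(1 + d))); last exact: aE.
  by rewrite /slice/= aE.
have fin_slice m : finite_set (slice m).
  apply: (@finite_preimage _ _ S
    (fun z : 'rV[int]_d => row_mx (m%:M : 'M[int]_1) z)) => //.
  by apply: in2W; exact: row_inj.
pose ms := fset_set (first @` S).
pose c m : R := #|` fset_set (slice m)|%:R * n%:R^-1 ^+ d.
pose I m := [set t : R | Num.floor (n%:R * t) = m].
rewrite /= (_ : (fun t => _) =
    fun t : R => (\sum_(m <- ms) (c m * \1_(I m) t)%:E)%E); last first.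
  apply/funext => t; pose m := Num.floor (n%:R * t).
  transitivity ((c m)%:E).
    rewrite -IH//; congr volume; apply/seteqP; split => y /=;
    by rewrite cell_index_row_mx.
  have It m' : \1_(I m') t = (m == m')%:R :> R.
    rewrite indicE; congr ((nat_of_bool _)%:R).
    by apply/idP/idP; rewrite inE => /eqP.
  rewrite sumEFin; congr (_%:E).
  under eq_bigr do rewrite It.
  have [mms|mms] := boolP (m \in ms).
    rewrite (big_fsetD1 _ mms)/= eqxx mulr1 big1_fset ?addr0// => m'.
    by rewrite !inE eq_sym => /andP[/negbTE -> _] _; rewrite mulr0.
  rewrite big1_fset => [|m' m'ms _].
    rewrite /c (_ : slice m = set0) ?fset_set0 ?mul0r//.
    apply/seteqP; split => // z Sz; exfalso; move/negP: mms; apply.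
    rewrite in_fset_set; last exact: finite_image.
    rewrite inE; exists (row_mx (m%:M : 'M[int]_1) z) => //.
    by have : (S `&` first @^-1` [set m]) (row_mx (m%:M : 'M[int]_1) z);
      [rewrite sliceE; exists z | case].
  case: eqP => [mm'|]; last by rewrite mulr0.
  by move: mms; rewrite mm' m'ms.
rewrite ge0_integral_sum//=; last 2 first.
- move=> m; apply/measurable_EFinP; apply: measurable_funM => //.
  by apply: measurable_indic; exact: (floor_cell_measure m n0).1.
- by move=> m t _; rewrite lee_fin mulr_ge0// mulr_ge0// exprn_ge0 ?invr_ge0.
rewrite (card_fset_set_fibers first finS) natr_sum mulr_suml -sumEFin.
apply: eq_bigr => m _.
rewrite sliceE card_fset_set_image_inj// exprSr mulrA EFinM -/(c m).
have [mI muI] := floor_cell_measure m n0.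
rewrite (@integralZl_indic _ _ _ lebesgue_measure _ _ (fun=> I m) (c m))//.
  by rewrite integral_indic// setIT; congr (_ * _)%E; exact: muI.
by rewrite ltNge mulr_ge0// exprn_ge0// invr_ge0//.
Qed.

End Volume.

(** * Asymptotic density of lattice points *)

Section Density.
Variables (R : realType) (d : nat).
Implicit Types (b : bool) (n : nat) (t r : R).

Local Notation nu := (unit_ball_volume R d).
Local Notation sd := (Num.sqrt (d%:R : R)).

Lemma enorm_cell_index n (x : 'rV[R]_d) :
  enorm (n%:R *: x - map_mx intr (cell_index n x)) <= sd.
Proof.
rewrite -[leRHS]mulr1; apply: enorm_le_sqrtM => i; rewrite !mxE.
have := floor_itv (n%:R * x 0 i); rewrite intrD => /andP[h1 h2].
by rewrite ger0_norm ?subr_ge0//; lra.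
Qed.

(** A point [n *: x] is within [sqrt d] of its cell index, so the cells with
    index in the ball of radius [n - sqrt d] lie in the unit ball scaled by
    [n], and those with index in the ball of radius [n + sqrt d] cover it. *)
Lemma unit_ball_volumeP n : (0 < n)%N ->
  (ball_count true (0 : 'rV[R]_d) (n%:R - sd))%:R <= nu * n%:R ^+ d /\
  nu * n%:R ^+ d <= (ball_count true (0 : 'rV[R]_d) (n%:R + sd))%:R.
Proof.
move=> n0; have nR : 0 < n%:R :> R by rewrite ltr0n.
have nd0 : 0 < n%:R ^+ d :> R by rewrite exprn_gt0.
pose B := [set x : 'rV[R]_d | enorm x <= 1].
pose S r := ball_points true (0 : 'rV[R]_d) r.
pose U r := [set x : 'rV[R]_d | S r (cell_index n x)].
have volU r : volume (U r) = ((ball_count true (0 : 'rV[R]_d) r)%:R / n%:R ^+ d)%:E.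
  by rewrite /U volume_cells// -?exprVn//; exact: finite_ball_points.
have enormn (x : 'rV[R]_d) : enorm (n%:R *: x) = n%:R * enorm x.
  by rewrite enormZ ger0_norm.
have lo : (volume (U (n%:R - sd)%R) <= volume B)%E.
  apply: volume_le => x; rewrite /U /S /ball_points /B /= sub0r enormN => xn.
  rewrite -(ler_pM2l nR) mulr1 -enormn.
  have := enorm_leD_dist (n%:R *: x) (map_mx intr (cell_index n x)).
  have := enorm_cell_index n x; lra.
have hi : (volume B <= volume (U (n%:R + sd)%R))%E.
  apply: volume_le => x; rewrite /U /S /ball_points /B /= sub0r enormN => xn.
  have := enorm_leD_dist (map_mx intr (cell_index n x)) (n%:R *: x).
  rewrite enormB enormn; have := enorm_cell_index n x.
  have : n%:R * enorm x <= n%:R * 1 by rewrite ler_pM2l.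
  lra.
have nuE : volume B = nu%:E.
  rewrite /unit_ball_volume fineK// ge0_fin_numE ?volume_ge0//.
  by rewrite (le_lt_trans hi)// volU ltry.
by move: lo hi; rewrite !volU nuE !lee_fin ler_pdivrMr// ler_pdivlMr.
Qed.

Lemma count_true0_gt0 t : 0 <= t -> (0 < ball_count true (0 : 'rV[R]_d) t)%N.
Proof.
move=> t0; rewrite cardfs_gt0; apply/fset0Pn; exists 0.
rewrite in_fset_set; last exact: finite_ball_points.
by rewrite inE /ball_points/= map_mx0 subrr enorm0.
Qed.

Lemma unit_ball_volume_gt0 : 0 < nu.
Proof.
have [+ _] := @unit_ball_volumeP (Num.truncn sd).+1 isT.
move=> h; have : 0 < nu * (Num.truncn sd).+1%:R ^+ d.
  apply: lt_le_trans h; rewrite ltr0n count_true0_gt0// subr_ge0 ltW//.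
  exact: truncnS_gt.
by rewrite pmulr_lgt0// exprn_gt0// ltr0n.
Qed.

(** Both bounds compare the real radius [t] with a nearby integer scale; the
    constant 2 leaves room for the rounding, and for a strict inequality
    between radii that makes the bounds valid for open and closed balls. *)
Lemma count0_le b t : 0 <= t ->
  (ball_count b (0 : 'rV[R]_d) t)%:R <= nu * (t + (sd + 2)) ^+ d.
Proof.
move=> t0; have s0 := sqrtr_ge0 (d%:R : R); have u0 : 0 <= t + sd by rewrite addr_ge0.
have /andP[lo hi] := truncn_itv u0.
set n := Num.truncn (t + sd) in lo hi.
have [h _] := @unit_ball_volumeP n.+1 isT.
apply: (le_trans (y := nu * n.+1%:R ^+ d)).
  apply: le_trans h; rewrite ler_nat; apply: leq_ball_count_lt; lra.
rewrite ler_pM2l ?unit_ball_volume_gt0// lerXn2r ?nnegrE ?addr_ge0//.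
by rewrite -natr1; lra.
Qed.

Lemma count0_ge b t : sd + 2 <= t ->
  nu * (t - (sd + 2)) ^+ d <= (ball_count b (0 : 'rV[R]_d) t)%:R.
Proof.
move=> st; have s0 := sqrtr_ge0 (d%:R : R); have u0 : 0 <= t - (sd + 2) by lra.
have /andP[lo hi] := truncn_itv u0.
set n := Num.truncn _ in lo hi.
have [_ h] := @unit_ball_volumeP n.+1 isT.
apply: (le_trans (y := nu * n.+1%:R ^+ d)); last first.
  apply: (le_trans h); rewrite ler_nat; apply: leq_ball_count_lt.
  by rewrite -natr1; lra.
by rewrite ler_pM2l ?unit_ball_volume_gt0// lerXn2r ?nnegrE// ltW.
Qed.

Lemma count0_density b r e : 0 < r -> 0 < e ->
  exists n0, forall n, (n0 <= n)%N -> (0 < n)%N ->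
    let q := (ball_count b (0 : 'rV[R]_d) (n%:R * r))%:R / n%:R ^+ d in
    nu * r ^+ d - e <= q <= nu * r ^+ d + e.
Proof.
move=> r0 e0; pose f (h : R) := nu * (r + h) ^+ d.
have cf : {for 0, continuous f}.
  apply: cvgM; first exact: cvg_cst.
  apply: (@continuous_comp _ _ _ (fun h : R => r + h) (fun x => x ^+ d)).
    by apply: cvgD; [exact: cvg_cst|exact: cvg_id].
  exact: exprn_continuous.
have /cvgrPdist_lt/(_ e e0) := cf.
move=> /nbhs_ballP[del /= del0 fdel].
have s0 := sqrtr_ge0 (d%:R : R); pose c := sd + 2; have c0 : 0 < c by rewrite /c; lra.
pose n0 := (Num.truncn (c / del + c / r)).+1.
exists n0 => n n0n n_gt0 /=; have nR : 0 < n%:R :> R by rewrite ltr0n.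
have cn : c / del + c / r < n%:R.
  by apply: lt_le_trans (truncnS_gt _) _; rewrite ler_nat.
have cd0 : 0 < c / del by rewrite divr_gt0.
have cr0 : 0 < c / r by rewrite divr_gt0.
have cdel : c / n%:R < del.
  by rewrite ltr_pdivrMr// mulrC -ltr_pdivrMr//; lra.
have crn : c <= n%:R * r by rewrite -ler_pdivrMr//; lra.
have cn0 : 0 < c / n%:R by rewrite divr_gt0.
have nd0 : 0 < n%:R ^+ d :> R by rewrite exprn_gt0.
have fE h : f h * n%:R ^+ d = nu * (n%:R * r + h * n%:R) ^+ d.
  by rewrite /f -mulrA -exprMn mulrDl [r * _]mulrC.
have fh h : `|h| <= c / n%:R -> `|f 0 - f h| < e.
  move=> hc; apply: fdel; rewrite /ball/= sub0r normrN.
  exact: le_lt_trans cdel.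
have f0 : f 0 = nu * r ^+ d by rewrite /f addr0.
rewrite ler_pdivlMr// ler_pdivrMr//; apply/andP; split.
  apply: (le_trans _ (count0_ge b crn)).
  have := fE (- (c / n%:R)); rewrite mulNr divfK ?gt_eqF// => <-.
  have : `|f 0 - f (- (c / n%:R))| < e by apply: fh; rewrite normrN gtr0_norm.
  by rewrite ler_pM2r// -f0 ltr_norml; lra.
have nr0 : 0 <= n%:R * r by rewrite mulr_ge0// ltW.
apply: (le_trans (count0_le b nr0)).
have := fE (c / n%:R); rewrite divfK ?gt_eqF// => <-.
have : `|f 0 - f (c / n%:R)| < e by apply: fh; rewrite gtr0_norm.
by rewrite ler_pM2r// -f0 ltr_norml; lra.
Qed.

End Density.

(** * Averaging the ball counts over a period *)

Section Average.
Variables (R : realType) (d : nat).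
Implicit Types (b : bool) (r : R).

Local Notation nu := (unit_ball_volume R d).

(** The points of a period of the grid of mesh [1/n], the corner having
    index [w0]. *)
Definition period_point (n : nat) (w0 : 'rV[int]_d) (w : {ffun 'I_d -> 'I_n}) :
    'rV[R]_d :=
  n%:R^-1 *: map_mx intr (w0 + \row_i (w i)%:Z).

(** Scaling by [n] turns the pairs of a grid point [y] of the period and a
    lattice point [a] into the lattice points [n (y - a)], each residue class
    modulo [n] being hit by a single [y]. *)
Lemma sum_ball_count_period b n (w0 : 'rV[int]_d) r : (0 < n)%N ->
  ball_count b (0 : 'rV[R]_d) (n%:R * r) =
  (\sum_(w : {ffun 'I_d -> 'I_n}) ball_count b (period_point w0 w) r)%N.
Proof.
case: n => // n _; have nR : 0 < n.+1%:R :> R by rewrite ltr0n.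
pose h (v : 'rV[int]_d) : {ffun 'I_d -> 'I_n.+1} :=
  [ffun i => inord (absz (modz (v 0 i - w0 0 i) n.+1%:Z))].
rewrite /ball_count (card_fset_set_fin_fibers h); last exact: finite_ball_points.
apply: eq_bigr => w _.
pose f (a : 'rV[int]_d) : 'rV[int]_d := w0 + \row_i (w i)%:Z - n.+1%:Z *: a.
have f_inj : injective f.
  move=> x y /addrI/oppr_inj/rowP xy; apply/rowP => i.
  by have := xy i; rewrite !mxE => /mulfI; apply.
rewrite -[RHS](card_fset_set_image_inj _ f_inj); last exact: finite_ball_points.
have fP a : ball_points b (0 : 'rV[R]_d) (n.+1%:R * r) (f a) =
            ball_points b (period_point w0 w) r a.
  rewrite /ball_points/= sub0r enormN.
  have -> : map_mx intr (f a) = n.+1%:R *: (period_point w0 w - map_mx intr a).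
    rewrite /f /period_point map_mxB scalerBr scalerA divff ?gt_eqF// scale1r.
    by congr (_ - _); apply/rowP => i; rewrite !mxE; exact: intrM.
  rewrite enormZ ger0_norm ?ltW//.
  by case: b => /=; rewrite ?ler_pM2l ?ltr_pM2l.
congr (#|` fset_set _|); apply/seteqP; split=> [v [Bv /= hv]|_ [a Ba <-]].
  pose a : 'rV[int]_d := \row_i (- divz (v 0 i - w0 0 i) n.+1%:Z).
  have fa : f a = v.
    apply/rowP => i; rewrite /f !mxE -hv ffunE inordK; last lia.
    have := divz_eq (v 0 i - w0 0 i) n.+1%:Z.
    have : 0 <= modz (v 0 i - w0 0 i) n.+1%:Z by rewrite modz_ge0.
    move: (modz _ _) (divz _ _) => M Q M0.
    by rewrite gez0_abs//; lra.
  by exists a => //; rewrite -fP fa.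
split; first by rewrite fP.
apply/ffunP => i; rewrite ffunE !mxE; apply: val_inj => /=.
have wi := ltn_ord (w i).
rewrite (_ : _ - _ = (- a 0 i) * n.+1%:Z + (w i)%:Z); last by ring.
by rewrite modzMDl modz_small ?inordK//; lia.
Qed.

Definition corner n j (w : {ffun 'I_d -> 'I_n}) : bool := [forall i, (w i < j)%N].

Lemma sum_corner n j : (j <= n)%N ->
  (\sum_(w : {ffun 'I_d -> 'I_n}) corner j w = j ^ d)%N.
Proof.
move=> jn; have cj : #|[pred i : 'I_n | (i < j)%N]| = j.
  by rewrite -sum1_card -(big_ord_widen n (fun=> 1%N) jn) sum1_card card_ord.
rewrite -[in RHS]cj -[X in (_ ^ X)%N]card_ord -card_ffun_on -sum1_card.
rewrite [RHS]big_mkcond/=; apply: eq_bigr => w _.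
have -> : corner j w = (w \in ffun_on [pred i : 'I_n | (i < j)%N]) by [].
by case: (_ \in _).
Qed.

Lemma corner_near n j (q : 'rV[R]_d) (w : {ffun 'I_d -> 'I_n}) :
  (0 < j)%N -> (0 < n)%N -> corner j w ->
  enorm (period_point (cell_index n q) w - q) <=
    Num.sqrt d%:R * (j%:R / n%:R).
Proof.
move=> j0 n0 /forallP cw; have nR : 0 < n%:R :> R by rewrite ltr0n.
apply: enorm_le_sqrtM => i; rewrite ler_pdivlMr// -[X in _ * X <= _](gtr0_norm nR) -normrM.
rewrite !mxE mulrBl mulrC mulrA divff ?gt_eqF// mul1r intrD -pmulrn.
have := floor_itv (n%:R * q 0 i); rewrite intrD [q 0 i * _]mulrC => /andP[h1 h2].
have wj : (w i)%:R + 1 <= j%:R :> R by rewrite natr1 ler_nat cw.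
have wi0 : 0 <= (w i)%:R :> R by [].
by rewrite ler_norml; apply/andP; split; lra.
Qed.

Section Bounds.
Variables (b : bool) (r : R) (q : 'rV[R]_d) (eta : R) (s : bool).
Hypotheses (r0 : 0 < r) (eta0 : 0 < eta).

Lemma exists_mesh : exists2 N, (0 < N)%N & Num.sqrt d%:R / N%:R <= eta.
Proof.
exists (Num.truncn (Num.sqrt d%:R / eta)).+1 => //.
rewrite ler_pdivrMr ?ltr0n// mulrC -ler_pdivrMr// ltW//.
exact: truncnS_gt.
Qed.

(** The mesh is refined to make the mean of the counts approach
    [nu * r ^+ d], while the proportion of the sample points that are known
    to be close to [q] stays equal to [N ^- d]: this keeps a deviation of the
    count near [q] visible in the limit. *)
Lemma exists_sampling N e : (0 < N)%N -> Num.sqrt d%:R / N%:R <= eta ->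
  0 < e -> exists n (w0 : 'rV[int]_d) (near_q : pred {ffun 'I_d -> 'I_n}),
  [/\ (0 < n)%N,
    forall w : {ffun 'I_d -> 'I_n}, near_q w ->
      enorm (period_point w0 w - q) <= eta,
    (\sum_(w : {ffun 'I_d -> 'I_n}) near_q w)%N%:R = n%:R ^+ d / N%:R ^+ d :> R &
    nu * r ^+ d - e <=
      (\sum_(w : {ffun 'I_d -> 'I_n}) ball_count b (period_point w0 w) r)%N%:R
        / n%:R ^+ d <=
    nu * r ^+ d + e].
Proof.
move=> N0 Neta e0; have [n0 dens] := count0_density d b r0 e0.
have NR : 0 < N%:R :> R by rewrite ltr0n.
pose j := n0.+1; pose n := (N * j)%N.
have n_gt0 : (0 < n)%N by rewrite muln_gt0 N0.
have n0n : (n0 <= n)%N by rewrite /n /j; nia.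
exists n, (cell_index n q), (corner j); split=> [//|w cw||].
- apply: le_trans Neta; apply: le_trans (corner_near q _ n_gt0 cw) _ => //.
  by rewrite /n natrM invfM [N%:R^-1 * _]mulrC mulVKf// pnatr_eq0.
- rewrite sum_corner ?leq_pmull// natrX /n natrM exprMn mulrC mulKf//.
  by rewrite expf_neq0// gt_eqF.
- by have := dens n n0n n_gt0; rewrite (sum_ball_count_period b (cell_index n q) r n_gt0).
Qed.

(** In this lemma and the next one, [s] tells whether the count is known to
    deviate from its bound in the ball of center [q] and radius [eta], in which
    case the resulting inequality is strict. *)
Lemma volume_ge_of_ball_count k :
  (forall y : 'rV[R]_d, (k <= ball_count b y r)%N) ->
  (forall y, enorm (y - q) <= eta -> (k + s <= ball_count b y r)%N) ->
  k%:R < nu * r ^+ d ?<= if ~~ s.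
Proof.
move=> hk hks; have [N N0 Neta] := exists_mesh.
have Nd0 : 0 < N%:R ^+ d :> R by rewrite exprn_gt0// ltr0n.
have main : k%:R + s%:R / N%:R ^+ d <= nu * r ^+ d.
  apply/ler_addgt0Pr => e e0.
  have [n [w0 [near_q [n_gt0 nearP nearE /andP[_ mean_le]]]]] :=
    exists_sampling N0 Neta e0.
  apply: le_trans mean_le.
  rewrite ler_pdivlMr ?exprn_gt0 ?ltr0n// mulrDl -mulrA.
  rewrite [_^-1 * _]mulrC -nearE -natrX -!natrM -natrD ler_nat.
  have -> : (k * n ^ d = \sum_(w : {ffun 'I_d -> 'I_n}) k)%N.
    by rewrite sum_nat_const card_ffun !card_ord mulnC.
  rewrite big_distrr -big_split/=; apply: leq_sum => w _.
  have [/nearP/hks|_] := boolP (near_q w); first by rewrite muln1.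
  by rewrite muln0 addn0.
case: s main => /=; rewrite ?mul0r ?addr0// => /(lt_le_trans _); apply.
by rewrite ltrDl divr_gt0.
Qed.

Lemma volume_le_of_ball_count m :
  (forall y : 'rV[R]_d, (ball_count b y r <= m)%N) ->
  (forall y, enorm (y - q) <= eta -> (ball_count b y r + s <= m)%N) ->
  nu * r ^+ d < m%:R ?<= if ~~ s.
Proof.
move=> hm hms; have [N N0 Neta] := exists_mesh.
have Nd0 : 0 < N%:R ^+ d :> R by rewrite exprn_gt0// ltr0n.
have main : nu * r ^+ d + s%:R / N%:R ^+ d <= m%:R.
  apply/ler_addgt0Pr => e e0.
  have [n [w0 [near_q [n_gt0 nearP nearE /andP[+ _]]]]] :=
    exists_sampling N0 Neta e0.
  have nd0 : 0 < n%:R ^+ d :> R by rewrite exprn_gt0// ltr0n.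
  set mean := _ / n%:R ^+ d => mean_ge.
  suff : mean + s%:R / N%:R ^+ d <= m%:R by lra.
  rewrite -(ler_pM2r nd0) mulrDl /mean divfK ?gt_eqF// -mulrA.
  rewrite [_^-1 * _]mulrC -nearE -natrX -!natrM -natrD ler_nat.
  have -> : (m * n ^ d = \sum_(w : {ffun 'I_d -> 'I_n}) m)%N.
    by rewrite sum_nat_const card_ffun !card_ord mulnC.
  rewrite big_distrr -big_split/=; apply: leq_sum => w _.
  have [/nearP/hms|_] := boolP (near_q w); first by rewrite muln1.
  by rewrite muln0 addn0.
case: s main => /=; rewrite ?mul0r ?addr0// => /(lt_le_trans _); apply.
by rewrite ltrDl divr_gt0.
Qed.

End Bounds.
End Average.

(** * Oscillation of the ball count in dimension at least two *)

Section Oscillation.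
Variable R : realType.

Lemma sqr_enormB d (x y : 'rV[R]_d) : enorm (x - y) ^+ 2 =
  enorm x ^+ 2 - 2 * (\sum_(i < d) x 0 i * y 0 i) + enorm y ^+ 2.
Proof.
rewrite !sqr_enorm mulr_sumr -sumrB -big_split/=.
by apply: eq_bigr => i _; rewrite !mxE; ring.
Qed.

Lemma enorm_int_eq0 d (a : 'rV[int]_d) :
  enorm (map_mx intr a : 'rV[R]_d) = 0 -> a = 0.
Proof.
move=> /enorm_eq0/rowP a0; apply/rowP => i; have := a0 i.
by rewrite !mxE => /eqP; rewrite intr_eq0 => /eqP.
Qed.

(** The candidates [r / i.+1] for [i < size P] are too many to be all roots. *)
Lemma exists_not_root (P : {poly R}) (r : R) : P != 0 -> 0 < r ->
  exists2 s, `|s| <= r & ~~ root P s.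
Proof.
move=> P0 r0; pose rs := [seq r / i.+1%:R | i <- iota 0 (size P)].
have [/allP allr|/allPn[s + sP]] := boolP (all (root P) rs); last first.
  move=> /mapP[i _ si]; exists s => //.
  rewrite si gtr0_norm ?divr_gt0// ler_pdivrMr//.
  by rewrite ler_peMr ?ler1n// ltW.
have := max_poly_roots P0 (introT allP allr).
rewrite size_map size_iota ltnn => H; exfalso.
suff rsU : uniq rs by have := H rsU.
rewrite map_inj_in_uniq ?iota_uniq// => i j _ _.
move=> /(mulfI (lt0r_neq0 r0))/invr_inj/eqP.
by rewrite eqr_nat => /eqP[].
Qed.

(** Among the points [(s, sqrt (r^2 - s^2), 0, ...)] of the sphere about [0],
    those that are on the sphere about some [a <> 0] have [s] among the roots
    of a nonzero polynomial.  On a line this fails: the two points of the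
    sphere may both be on other spheres. *)
Lemma generic_sphere_point d (r : R) : (1 < d)%N -> 0 < r ->
  exists2 y : 'rV[R]_d, enorm y = r &
    forall a : 'rV[int]_d, a != 0 -> enorm (y - map_mx intr a) != r.
Proof.
case: d => [|[|d]]// _ r0.
pose nrm (a : 'rV[int]_d.+2) : R := enorm (map_mx intr a : 'rV[R]_d.+2) ^+ 2.
pose a1 (a : 'rV[int]_d.+2) : R := (a 0 0)%:~R.
pose a2 (a : 'rV[int]_d.+2) : R := (a 0 (lift 0 0))%:~R.
pose P a : {poly R} := ((nrm a)%:P - (2 * a1 a) *: 'X) ^+ 2
   - (4 * a2 a ^+ 2) *: ((r ^+ 2)%:P - 'X ^+ 2).
have PE a s : (P a).[s] =
    (nrm a - 2 * a1 a * s) ^+ 2 - 4 * a2 a ^+ 2 * (r ^+ 2 - s ^+ 2).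
  by rewrite /P !hornerE.
have P_neq0 a : a != 0 -> P a != 0.
  move=> a0; apply/eqP => Pa.
  (* At [r] and [- r] the subtracted term of [P a] vanishes, while the two
     squares cannot both vanish. *)
  have := PE a r; have := PE a (- r); rewrite Pa !hornerE sqrrN subrr !mulr0 !subr0.
  move=> /esym/eqP; rewrite sqrf_eq0 => /eqP e1 /esym/eqP.
  rewrite sqrf_eq0 => /eqP e2.
  have : nrm a == 0 by apply/eqP; lra.
  by rewrite sqrf_eq0 => /eqP/enorm_int_eq0/eqP; rewrite (negbTE a0).
(* A sphere of radius [r] through [y] has its center within [2 r] of [0]. *)
pose F := fset_set (ball_points true (0 : 'rV[R]_d.+2) (r + r)).
have [|s sr sP] := @exists_not_root (\prod_(a <- F | a != 0) P a) r _ r0.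
  by rewrite prodf_seq_neq0; apply/allP => a _; apply/implyP; exact: P_neq0.
pose t := Num.sqrt (r ^+ 2 - s ^+ 2).
have tE : t ^+ 2 = r ^+ 2 - s ^+ 2.
  rewrite sqr_sqrtr// subr_ge0 -[s ^+ 2]real_normK ?num_real//.
  by rewrite lerXn2r ?nnegrE// ltW.
pose y : 'rV[R]_d.+2 :=
  \row_i (if i == 0 then s else if i == lift 0 0 then t else 0).
have y_dot (f : 'I_d.+2 -> R -> R) : (forall i, f i 0 = 0) ->
    \sum_(i < d.+2) f i (y 0 i) = f 0 s + f (lift 0 0) t.
  move=> f0; rewrite !big_ord_recl big1 ?addr0 => [|i _].
    by rewrite !mxE !eqxx.
  by rewrite !mxE.
have yr : enorm y = r.
  apply/eqP; rewrite -(@eqrXn2 _ 2)// ?enorm_ge0 ?ltW// sqr_enorm.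
  by rewrite (y_dot (fun _ z => z ^+ 2)) ?tE ?expr0n//; apply/eqP; ring.
exists y => // a a0; apply/eqP => yar.
move/negP: sP; apply; apply/rootP; rewrite horner_prod.
have aF : a \in F.
  rewrite in_fset_set ?inE; last exact: finite_ball_points.
  rewrite /ball_points/= sub0r enormN.
  have := enorm_leD_dist (map_mx intr a) y.
  by rewrite yr enormB yar.
apply/eqP; rewrite prodf_seq_eq0; apply/hasP; exists a => //.
rewrite a0 PE/= -tE subr_eq0.
have := sqr_enormB y (map_mx intr a); rewrite yar yr -/(nrm a).
rewrite (y_dot (fun i z => z * (map_mx intr a : 'rV[R]_d.+2) 0 i)); last first.
  by move=> i; rewrite mul0r.
rewrite !mxE -/(a1 a) -/(a2 a) => H.
have -> : nrm a - 2 * a1 a * s = 2 * a2 a * t by lra.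
by apply/eqP; ring.
Qed.

(** At a generic point [y] of the sphere about [0] of radius [r], entering
    this ball changes no other incidence: the count jumps between the points
    [p] just outside and [q] just inside. *)
Lemma ball_count_oscillation d (r : R) : (1 < d)%N -> 0 < r ->
  exists p q : 'rV[R]_d, exists2 eta, 0 < eta &
    (ball_count true p (r + eta) < ball_count false q (r - eta))%N.
Proof.
move=> d1 r0; have [y yr ygen] := generic_sphere_point d1 r0.
have [g g0 gap] := distance_gap y r.
(* [p] and [q] are at distance [2 * eta] from [y] and the radii change by
   [eta], which amounts to less than the gap [g]. *)
pose eta := Num.min (g / 4) (r / 4).
have eta0 : 0 < eta by rewrite lt_min !divr_gt0.
have eg : eta <= g / 4 by rewrite ge_min lexx.
have er : eta <= r / 4 by rewrite ge_min lexx orbT.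
pose u := 2 * eta / r; have ur : u * r = 2 * eta by rewrite divfK ?gt_eqF.
have u0 : 0 < u by rewrite !mulr_gt0 ?invr_gt0.
have u1 : u < 1 by rewrite ltr_pdivrMr// mul1r; lra.
pose p := (1 + u) *: y; pose q := (1 - u) *: y.
have py : enorm (p - y) = 2 * eta.
  by rewrite /p scalerDl scale1r addrC addKr enormZ yr gtr0_norm.
have qy : enorm (q - y) = 2 * eta.
  by rewrite /q scalerBl scale1r addrC addKr enormN enormZ yr gtr0_norm.
have p_norm : enorm p = r + 2 * eta.
  by rewrite enormZ yr gtr0_norm ?mulrDl ?mul1r ?ur//; lra.
have q_norm : enorm q = r - 2 * eta.
  by rewrite enormZ yr gtr0_norm ?mulrBl ?mul1r ?ur ?subr_gt0.
exists p, q, eta => //; apply/fproper_ltn_card; rewrite fproperE.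
apply/andP; split.
  rewrite -fset_set_sub; try exact: finite_ball_points.
  move=> a; rewrite /ball_points/= => pa.
  have [a0|a0] := eqVneq a 0.
    by move: pa; rewrite a0 map_mx0 subr0 p_norm; lra.
  have := gap a (ygen a a0).
  have := enorm_triangle y p (map_mx intr a); rewrite [enorm (y - p)]enormB py.
  have := enorm_triangle q y (map_mx intr a); rewrite qy.
  have [yar|yar] := ltP (enorm (y - map_mx intr a)) r.
    by rewrite ltr0_norm ?subr_lt0//; lra.
  by rewrite ger0_norm ?subr_ge0//; lra.
apply/negP; rewrite -fset_set_sub; try exact: finite_ball_points.
move=> /(_ 0); rewrite /ball_points/= map_mx0 !subr0 p_norm q_norm => H.
have : r - 2 * eta < r - eta by lra.
by move=> /H; lra.
Qed.

End Oscillation.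

(** * Volume bounds from uniform bounds on the ball count *)

Section UniformBounds.
Variables (R : realType) (d : nat).
Hypothesis d_gt0 : (0 < d)%N.

(** A point with half-integer coordinates shows that a covering radius is at
    least 1/2, in particular positive. *)
Lemma ball_count_half (r : R) : r < 2^-1 ->
  ball_count true (const_mx 2^-1 : 'rV[R]_d) r = 0%N.
Proof.
move=> r2; rewrite /ball_count (_ : ball_points _ _ _ = set0) ?fset_set0//.
apply/seteqP; split => // a; rewrite /ball_points/= leNgt => /negP; apply.
apply: (lt_le_trans r2); apply: le_trans (normr_le_enorm _ (Ordinal d_gt0)).
rewrite !mxE; have [a0|a0] := leP (a 0 (Ordinal d_gt0)) 0.
  have : (a 0 (Ordinal d_gt0))%:~R <= 0 :> R by rewrite lerz0.
  by move=> ?; rewrite ger0_norm; lra.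
have : 1 <= (a 0 (Ordinal d_gt0))%:~R :> R by rewrite ler1z.
by move=> ?; rewrite ler0_norm; lra.
Qed.

(** If [q] is a point where the count jumps above the count at [p], which is
    at least [k], the count is at least [k + 1] around [q]. *)
Lemma volume_ge_of_covering (k : nat) (r : R) : (0 < k)%N ->
  (forall y : 'rV[R]_d, (k <= ball_count true y r)%N) ->
  k%:R < unit_ball_volume R d * r ^+ d ?<= if (d == 1)%N.
Proof.
move=> k0 hk.
have r0 : 0 < r.
  rewrite ltNge; apply/negP => r0; have := hk (const_mx 2^-1).
  rewrite ball_count_half; first by rewrite leqNgt k0.
  by apply: (le_lt_trans r0); rewrite invr_gt0.
have [d1|d1] := boolP (d == 1)%N.
  apply: (@volume_ge_of_ball_count R d true r 0 1 false) => //.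
  by move=> y _; rewrite addn0.
have d2 : (1 < d)%N by lia.
have [p [q [eta eta0 pq]]] := ball_count_oscillation d2 r0.
apply: (@volume_ge_of_ball_count R d true r q eta true) => // y yq.
rewrite addn1; apply: (leq_ltn_trans (hk p)).
have r_eta : r <= r + eta by lra.
apply: (leq_ltn_trans (leq_ball_count_radius true p r_eta)).
apply: (leq_trans pq); apply: (leq_trans _ (leq_ball_count_strict y r)).
by apply: leq_ball_count_move; rewrite enormB; lra.
Qed.

(** The count at [q] is at most [m], hence at most [m - 1] around [p]. *)
Lemma volume_le_of_packing (m : nat) (r : R) : 0 < r ->
  (forall y : 'rV[R]_d, (ball_count false y r <= m)%N) ->
  unit_ball_volume R d * r ^+ d < m%:R ?<= if (d == 1)%N.
Proof.
move=> r0 hm; have [d1|d1] := boolP (d == 1)%N.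
  apply: (@volume_le_of_ball_count R d false r 0 1 false) => //.
  by move=> y _; rewrite addn0.
have d2 : (1 < d)%N by lia.
have [p [q [eta eta0 pq]]] := ball_count_oscillation d2 r0.
apply: (@volume_le_of_ball_count R d false r p eta true) => // y yp.
rewrite addn1; apply: leq_trans (hm q).
apply: leq_ltn_trans (leq_ball_count_strict _ _) _.
apply: (@leq_ltn_trans (ball_count true p (r + eta))).
  by apply: leq_ball_count_move; lra.
apply: (leq_trans pq); apply: leq_ball_count_radius; lra.
Qed.

End UniformBounds.

(** * The extreme k-th distances *)

Section ExtremeDistances.
Variables (R : realType) (d k : nat).
Hypotheses (d_gt0 : (0 < d)%N) (k_gt0 : (0 < k)%N).

Lemma is_kth_distance_translate (x : 'rV[R]_d) (c : 'rV[int]_d) r :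
  is_kth_distance k (x + map_mx intr c) r <-> is_kth_distance k x r.
Proof. by rewrite /is_kth_distance !ball_count_translate. Qed.

(** The [k]-th distance is continuous, and by periodicity its values on the
    compact unit cube are all its values. *)
Lemma exists_extreme_kth_distances : exists xmin xmax : 'rV[R]_d,
  exists rmin rmax : R, [/\ is_kth_distance k xmin rmin,
    is_kth_distance k xmax rmax &
    forall (x : 'rV[R]_d) r, is_kth_distance k x r -> rmin <= r <= rmax].
Proof.
have /choice[D DP] : forall x : 'rV[R]_d, exists r, is_kth_distance k x r.
  by move=> x; exact: exists_kth_distance.
have contD : continuous D.
  move=> x; apply: (@cvgrPdist_lt _ _ _ _ (nbhs_filter x) _ _).2 => e e0.
  pose s := Num.sqrt d%:R + 1 : R.
  have s0 : 0 < s by rewrite ltr_wpDl ?sqrtr_ge0.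
  apply/nbhs_ballP; exists (e / s) => [|y xy] /=; first by rewrite divr_gt0.
  have xy_e : enorm (x - y) < e.
    apply: (@le_lt_trans _ _ (Num.sqrt d%:R * (e / s))).
      apply: enorm_le_sqrtM => i; rewrite !mxE ltW//.
      by have := xy.2 0 i.
    rewrite mulrA ltr_pdivrMr// mulrC ltr_pM2l// /s; lra.
  have := kth_distance_lipschitz (DP x) (DP y).
  have := kth_distance_lipschitz (DP y) (DP x); rewrite enormB.
  by rewrite ltr_norml; lra.
pose A := [set v : 'rV[R]_d | forall i, `[0, 1]%classic (v 0 i)].
have cA : compact A.
  by apply: (@rV_compact R d (fun=> `[0, 1]%classic)) => i; exact: segment_compact.
have A0 : A !=set0.
  by exists 0 => i /=; rewrite mxE in_itv/= lexx ler01.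
have cDA : {within A, continuous D} by exact: continuous_subspaceT.
have [xmin _ xminP] := EVT_min_rV A0 cA cDA.
have [xmax _ xmaxP] := EVT_max_rV A0 cA cDA.
exists xmin, xmax, (D xmin), (D xmax); split=> // x r xr.
pose c : 'rV[int]_d := \row_i (- Num.floor (x 0 i)).
have -> : r = D (x + map_mx intr c).
  apply: (@kth_distance_uniq R d k (x + map_mx intr c)); last exact: DP.
  by apply/is_kth_distance_translate.
have cA' : x + map_mx intr c \in A.
  rewrite inE => i /=; rewrite in_itv/= !mxE intrN.
  by have := floor_itv (x 0 i); rewrite intrD; lra.
by rewrite xminP// xmaxP.
Qed.

(** * Brillouin zones and k-th distances *)

Lemma finite_card_le_II (T : choiceType) (A : set T) m : finite_set A ->
  (A #<= `I_m) = (#|` fset_set A| <= m)%N.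
Proof.
move=> /finite_setP[n An]; rewrite (card_fset_set An) (card_le_eql An).
by rewrite card_le_II.
Qed.

Lemma finite_card_ge_II (T : choiceType) (A : set T) m : finite_set A ->
  (`I_m #<= A) = (m <= #|` fset_set A|)%N.
Proof.
move=> /finite_setP[n An]; rewrite (card_fset_set An) (card_le_eqr An).
by rewrite card_le_II.
Qed.

Lemma map_intr_inj : injective (fun a : 'rV[int]_d => map_mx intr a : 'rV[R]_d).
Proof.
move=> a b /rowP ab; apply/rowP => i; have := ab i; rewrite !mxE.
exact: intr_inj.
Qed.

Lemma integer_latticeP (p : 'rV[R]_d) :
  integer_lattice R d p <-> exists a : 'rV[int]_d, p = map_mx intr a.
Proof.
split=> [pZ|[a ->] i]; last by rewrite mxE intr_int.
exists (\row_i Num.floor (p 0 i)); apply/rowP => i; rewrite !mxE.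
by have := pZ i; rewrite intrEfloor => /eqP.
Qed.

(** The two sets that define the zone leave out [p] itself: this is harmless
    for the open ball, which does not contain [p], and removes one point of the
    closed ball, so that [k - 1] becomes [k]. *)
Lemma brillouin_zoneP (p : 'rV[R]_d) x : integer_lattice R d p ->
  brillouin_zone k (integer_lattice R d) p x <->
  is_kth_distance k x (enorm (x - p)).
Proof.
move=> /integer_latticeP[c pc]; set r := enorm (x - p).
pose emb (a : 'rV[int]_d) : 'rV[R]_d := map_mx intr a.
have lt_set : [set a | [/\ integer_lattice R d a, a <> p & enorm (x - a) < r]]
    = emb @` ball_points false x r.
  apply/seteqP; split=> [_ [/integer_latticeP[a ->] _ ar]|_ [a ar <-]].
    by exists a.
  split=> //; first by apply/integer_latticeP; exists a.
  by move=> ap; move: ar; rewrite /ball_points/= -/(emb a) ap ltxx.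
have le_set : [set b | [/\ integer_lattice R d b, b <> p & enorm (x - b) <= r]]
    = emb @` (ball_points true x r `\ c).
  apply/seteqP; split=> [_ [/integer_latticeP[a ->] ap ar]|_ [a [ar ac] <-]].
    by exists a => //; split => // ac; apply: ap; rewrite pc ac.
  split=> //; first by apply/integer_latticeP; exists a.
  by rewrite pc => /map_intr_inj.
have finF := finite_ball_points false x r.
have finT : finite_set (ball_points true x r `\ c).
  by apply: finite_setD; exact: finite_ball_points.
rewrite /brillouin_zone/= lt_set le_set.
rewrite (card_le_eql (inj_card_eq (in2W map_intr_inj))).
rewrite (card_le_eqr (inj_card_eq (in2W map_intr_inj))).
rewrite finite_card_le_II// finite_card_ge_II//.
rewrite fset_setD1; last exact: finite_ball_points.
have := cardfsD1 c (fset_set (ball_points true x r)).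
rewrite in_fset_set; last exact: finite_ball_points.
rewrite mem_set; last by rewrite /ball_points/= -pc.
rewrite /is_kth_distance /ball_count => ->.
by split=> [[]|/andP[]]; lia.
Qed.

(** If the lattice point [a] is at distance [r] from [x], the translation that
    sends [a] to [p] sends [x] into the zone of [p]. *)
Lemma zone_distancesP (p : 'rV[R]_d) r : integer_lattice R d p ->
  zone_distances k (integer_lattice R d) p r <->
  exists x : 'rV[R]_d, is_kth_distance k x r.
Proof.
move=> pZ; split=> [[x /(brillouin_zoneP _ pZ) xk <-]|[x xr]].
  by exists x.
have /integer_latticeP[c pc] := pZ.
(* Some lattice point is at distance exactly [r], as the closed ball has more
   lattice points than the open one. *)
have [a ar] : exists a : 'rV[int]_d, enorm (x - map_mx intr a) = r.
  apply: contrapT => /forallNP nor.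
  have /andP[h1 h2] := xr.
  suff : (ball_count true x r <= ball_count false x r)%N by lia.
  apply: leq_ball_count => a; rewrite /ball_points/= lt_neqAle => ->.
  by rewrite andbT; apply/eqP.
have shift : x + map_mx intr (c - a) - p = x - map_mx intr a.
  by rewrite pc map_mxB addrCA addrAC subrr add0r.
exists (x + map_mx intr (c - a)); last by rewrite shift.
by apply/(brillouin_zoneP _ pZ); rewrite shift ar; apply/is_kth_distance_translate.
Qed.

End ExtremeDistances.

(** * Assembling the bounds *)

Section NthRoot.
Variables (R : realType) (d : nat).
Hypothesis d_gt0 : (0 < d)%N.
Implicit Types (x r : R) (C : bool).

Lemma nth_root_ge0 x : 0 <= nth_root d x.
Proof. exact: powR_ge0. Qed.

Lemma nth_rootK x : 0 <= x -> nth_root d x ^+ d = x.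
Proof.
move=> x0; rewrite /nth_root -powR_mulrn ?powR_ge0// -powRrM mulVf.
  by rewrite powRr1.
by rewrite pnatr_eq0 -lt0n.
Qed.

Lemma lteif_nth_rootl C x r : 0 <= x -> 0 <= r ->
  (nth_root d x < r ?<= if C) = (x < r ^+ d ?<= if C).
Proof.
move=> x0 r0; rewrite -{2}(nth_rootK x0).
by case: C => /=; rewrite ?ler_pXn2r ?ltr_pXn2r ?nnegrE ?nth_root_ge0.
Qed.

Lemma lteif_nth_rootr C x r : 0 <= x -> 0 <= r ->
  (r < nth_root d x ?<= if C) = (r ^+ d < x ?<= if C).
Proof.
move=> x0 r0; rewrite -{2}(nth_rootK x0).
by case: C => /=; rewrite ?ler_pXn2r ?ltr_pXn2r ?nnegrE ?nth_root_ge0.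
Qed.

End NthRoot.

(** Up to a translation by a lattice point, any two points are at distance at
    most half the diagonal of the unit cube. *)
Lemma leq_ball_count_half_diagonal (R : realType) d b (x y : 'rV[R]_d) r :
  (ball_count b x r <= ball_count b y (r + Num.sqrt d%:R / 2))%N.
Proof.
pose c : 'rV[int]_d := \row_i Num.floor (y 0 i - x 0 i + 2^-1).
rewrite -(ball_count_translate b x r c); apply: leq_ball_count_move.
rewrite addrC lerD2l; apply: enorm_le_sqrtM => i; rewrite !mxE.
have := floor_itv (y 0 i - x 0 i + 2^-1); rewrite intrD => /andP[h1 h2].
by rewrite ler_norml; apply/andP; split; lra.
Qed.

(* [x < y ?<= if b] is [x <= y] when b holds and [x < y] otherwise.  The
   strict form fails exactly in the cases b: for d = 1 one has
   r_k = (k - 1) / 2 and R_k = k / 2 with nu_1 = 2, and for k = 1 both r_1 and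
   its upper bound are 0. *)
Theorem theorem3p1 (R : realType) (d k : nat) (hd : (1 <= d)%N)
    (hk : (1 <= k)%N) :
  exists r_k R_k : R,
    (forall p : 'rV[R]_d, integer_lattice R d p ->
       is_minimum (zone_distances k (integer_lattice R d) p) r_k /\
       is_maximum (zone_distances k (integer_lattice R d) p) R_k) /\
    let nu_d := unit_ball_volume R d in
    let W_k := R_k - r_k in
    [/\ nth_root d (k%:R / nu_d) - Num.sqrt d%:R / 2 < r_k
          ?<= if (d == 1)%N
      , r_k < nth_root d ((k%:R - 1) / nu_d)
          ?<= if ((d == 1) || (k == 1))%N
      & nth_root d (k%:R / nu_d) < R_k
          ?<= if (d == 1)%N] /\
    [/\ R_k < nth_root d (k%:R / nu_d) + Num.sqrt d%:R / 2
      , nth_root d (k%:R / nu_d) - nth_root d ((k%:R - 1) / nu_d) < W_k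
          ?<= if (d == 1)%N
      & W_k < Num.sqrt d%:R].
Proof.
have [xmin [xmax [rmin [rmax [kmin kmax kext]]]]] :=
  exists_extreme_kth_distances R hd hk.
exists rmin, rmax; split.
  move=> p pZ; split; split.
  - by apply/zone_distancesP => //; exists xmin.
  - by move=> r /(zone_distancesP hd hk r pZ)[x /kext/andP[]].
  - by apply/zone_distancesP => //; exists xmax.
  - by move=> r /(zone_distancesP hd hk r pZ)[x /kext/andP[]].
move=> nu W_k; pose h : R := Num.sqrt d%:R / 2.
have sqrtE : Num.sqrt d%:R = h + h by rewrite /h -splitr.
have h_gt0 : 0 < h by rewrite divr_gt0// sqrtr_gt0 ltr0n.
have nu_gt0 : 0 < nu := unit_ball_volume_gt0 R d.
have k1E : (k%:R - 1 : R) = (k - 1)%:R by rewrite natrB.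
have rmin_ge0 := kth_distance_ge0 kmin.
have rmax_ge0 := kth_distance_ge0 kmax.
have div_nu_ge0 n : 0 <= n%:R / nu by rewrite divr_ge0// ltW.
have scalel C n r : (n%:R / nu < r ?<= if C) = (n%:R < nu * r ?<= if C).
  by rewrite [nu * r]mulrC; case: C => /=; rewrite ?ler_pdivrMr ?ltr_pdivrMr.
have scaler C n r : (r < n%:R / nu ?<= if C) = (nu * r < n%:R ?<= if C).
  by rewrite [nu * r]mulrC; case: C => /=; rewrite ?ler_pdivlMr ?ltr_pdivlMr.
pose A := nth_root d (k%:R / nu); pose B := nth_root d ((k - 1)%:R / nu).
have B_ge0 : 0 <= B by exact: nth_root_ge0.
have AB : B < A.
  rewrite -lteifF lteif_nth_rootl ?nth_root_ge0// nth_rootK//=.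
  by rewrite ltr_pM2r ?invr_gt0// ltr_nat; lia.
have lower_min : A < rmin + h ?<= if (d == 1)%N.
  rewrite lteif_nth_rootl ?addr_ge0// ?(ltW h_gt0)// scalel.
  apply: volume_ge_of_covering => // y.
  have /andP[_ /leq_trans] := kmin; apply.
  exact: leq_ball_count_half_diagonal.
have lower_max : A < rmax ?<= if (d == 1)%N.
  rewrite lteif_nth_rootl// scalel; apply: volume_ge_of_covering => // y.
  have [r yr] := exists_kth_distance y hd hk.
  have /andP[_ rrmax] := kext _ _ yr; have /andP[_ /leq_trans] := yr; apply.
  exact: leq_ball_count_radius.
have upper_max : rmax <= B + h.
  have [rh|rh] := leP rmax h; first lra.
  suff : rmax - h < B ?<= if (d == 1)%N by move=> /lteifW; lra.
  rewrite lteif_nth_rootr ?subr_ge0 ?(ltW rh)// scaler.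
  apply: volume_le_of_packing => //; first by rewrite subr_gt0.
  move=> y; have /andP[kr _] := kmax.
  have := leq_ball_count_half_diagonal false y xmax (rmax - h).
  by rewrite subrK => /leq_trans; apply; lia.
have upper_min : rmin < B ?<= if ((d == 1) || (k == 1))%N.
  move: rmin_ge0; rewrite le_eqVlt => /predU1P[r0|r_gt0].
    rewrite -r0; case: (d == 1)%N => //=; have [//|k1] := boolP (k == 1)%N.
    by apply/powR_gt0/divr_gt0 => //; rewrite ltr0n; lia.
  rewrite lteif_orb; apply/orP; left.
  rewrite lteif_nth_rootr ?(ltW r_gt0)// scaler.
  apply: volume_le_of_packing => // y.
  have [r yr] := exists_kth_distance y hd hk.
  have /andP[rminr _] := kext _ _ yr; have /andP[kr _] := yr.
  have := leq_ball_count_radius false y rminr; lia.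
rewrite k1E -/A -/B -/h sqrtE; split; split.
- by move: lower_min; case: (d == 1)%N => /=; lra.
- exact: upper_min.
- exact: lower_max.
- lra.
- have rB := lteifW upper_min; rewrite /W_k.
  by move: lower_max; case: (d == 1)%N => /=; lra.
- have := lteifW lower_min; rewrite /W_k; lra.
Qed.
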